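(* Let $Q_{\rm a}=Q_{\rm a}^\top>0$ in $\mathbb R^{n\times n}$ and $R_{\rm a}=R_{\rm a}^\top>0$ in $\mathbb R^{m\times m}$, let $\beta>0$, $0<2\alpha_0<\beta$, $\varepsilon\ge0$ and $\vartheta\in(0,1)$. Set $K_{\rm a}^0=0$, $c_0=\alpha_0$, $r_{\max}=\max\{0,s(\mathcal L_{K_{\rm a}^0})\}$ and $\bar r=r_{\max}+\beta$. For $k=0,1,2,\ldots$, let $P_{\rm a}^k=P_{\rm a}^{k\top}$ solve $$\begin{aligned}0={}&\left(A-\tfrac{\bar r}{2}I_n+c_kI_n-BK_{\rm a}^k\right)^\top P_{\rm a}^k+P_{\rm a}^k\left(A-\tfrac{\bar r}{2}I_n+c_kI_n-BK_{\rm a}^k\right)\\&+(C-DK_{\rm a}^k)^\top P_{\rm a}^k(C-DK_{\rm a}^k)+Q_{\rm a}+(K_{\rm a}^k)^\top R_{\rm a}K_{\rm a}^k,\end{aligned}$$ update $$K_{\rm a}^{k+1}=\left(R_{\rm a}+D^\top P_{\rm a}^kD\right)^{-1}\left(B^\top P_{\rm a}^k+D^\top P_{\rm a}^kC\right),$$ and select $$\alpha_{k+1}=\frac{\vartheta\lambda_{\min}(Q_{\rm a})}{2\lambda_{\max}(P_{\rm a}^k)},\qquad c_{k+1}=c_k+\alpha_{k+1}.$$ Then for every $k\ge0$, $$s\bigl(\mathcal L^{\rm a}_{K_{\rm a}^k,c_k}\bigr)<0,\qquad s\bigl(\mathcal L_{K_{\rm a}^k}\bigr)<\bar r-2c_k,$$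 and the step length satisfies $$0<\alpha_{k+1}<-\tfrac12\, s\bigl(\mathcal L^{\rm a}_{K_{\rm a}^{k+1},c_k}\bigr).$$ Consequently, if $\bar r-2c_{k_\star}<-\varepsilon\le0$ holds for an index $k_\star$, then $K^\dagger:=K_{\rm a}^{k_\star}\in\mathscr K_{\rm ms}$ and $s(\mathcal L_{K^\dagger})<-\varepsilon$.
   Context: $\mathbb S^n$ is the space of real symmetric $n\times n$ matrices; $>0$ means positive definite; $\lambda_{\min},\lambda_{\max}$ are the smallest and largest eigenvalues of a symmetric matrix. $A\in\mathbb R^{n\times n}$, $B\in\mathbb R^{n\times m}$, $C\in\mathbb R^{n\times n}$, $D\in\mathbb R^{n\times m}$ are constant matrices. For $K\in\mathbb R^{m\times n}$, the operator $\mathcal L_K$ on $\mathbb S^n$ is $$\mathcal L_K(Z)=(A-BK)Z+Z(A-BK)^\top+(C-DK)Z(C-DK)^\top,$$ and for $\bar r>0$, $c\in\mathbb R$ the operator $\mathcal L^{\rm a}_{K,c}$ on $\mathbb S^n$ is $$\mathcal L^{\rm a}_{K,c}(Z)=\left(A-\tfrac{\bar r}{2}I_n+cI_n-BK\right)Z+Z\left(A-\tfrac{\bar r}{2}I_n+cI_n-BK\right)^\top+(C-DK)Z(C-DK)^\top .$$ For a linear operator $\mathcal A$, $\sigma(\mathcal A)\subset\mathbb C$ is its spectrum (complex eigenvalues) and $s(\mathcal A)=\max_{\lambda\in\sigma(\mathcal A)}\operatorname{Re}\lambda$. The set of mean-square stabilizing gains is $\mathscr K_{\rm ms}=\{K\in\mathbb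 R^{m\times n}:s(\mathcal L_K)<0\}$. *)

(* Defs.v *)
From mathcomp Require Import all_boot all_order all_algebra.
From mathcomp Require Import complex.
From mathcomp Require Import boolp classical_sets reals.

Set Implicit Arguments.
Unset Strict Implicit.
Unset Printing Implicit Defensive.

Import Order.TTheory GRing.Theory Num.Theory.

Local Open Scope classical_set_scope.
Local Open Scope complex_scope.
Local Open Scope ring_scope.

(* Greatest and least elements of a set of reals. The value is the default 0
   when there is none; below they are applied to spectra of operators on
   nonzero finite-dimensional spaces, which are finite and nonempty (for real
   eigenvalues: of symmetric matrices). *)
Definition set_max (R : realType) (S : set R) : R :=
  xget 0 [set x | S x /\ ubound S x].

Definition set_min (R : realType) (S : set R) : R :=
  xget 0 [set x | S x /\ lbound S x].

(* Used for symmetric M only, all of whose complex eigenvalues are real. *)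
Definition lambda_max (R : realType) (n : nat) (M : 'M[R]_n) : R :=
  set_max [set a | eigenvalue M a].

Definition lambda_min (R : realType) (n : nat) (M : 'M[R]_n) : R :=
  set_min [set a | eigenvalue M a].

Definition symmx (T : Type) (n : nat) (M : 'M[T]_n) : Prop := M^T = M.

Definition posdef (R : realType) (n : nat) (M : 'M[R]_n) : Prop :=
  symmx M /\
  forall v : 'cV[R]_n, v != 0 -> 0 < (v^T *m M *m v) ord0 ord0.

(* A linear operator on the real symmetric matrices is represented by a map L
   on all square matrices that preserves symmetry, of which only the values at
   symmetric matrices matter. Its complexification acts on complex symmetric
   matrices by X + iY |-> L X + i L Y. *)
Definition complexify (R : realType) (n : nat) (L : 'M[R]_n -> 'M[R]_n)
    (Z : 'M[R[i]]_n) : 'M[R[i]]_n :=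
  \matrix_(j, k) (L (map_mx (@complex.Re R) Z) j k
                  +i* L (map_mx (@complex.Im R) Z) j k).

(* Z^T is the plain transpose: the complexification of the space of real
   symmetric matrices consists of complex symmetric, not Hermitian, matrices. *)
Definition spectrum (R : realType) (n : nat) (L : 'M[R]_n -> 'M[R]_n) :
    set R[i] :=
  [set l | exists Z : 'M[R[i]]_n,
     [/\ symmx Z, Z != 0 & complexify L Z = l *: Z]].

Definition spectral_abscissa (R : realType) (n : nat)
    (L : 'M[R]_n -> 'M[R]_n) : R :=
  set_max [set complex.Re l | l in spectrum L].

Definition opL (R : realType) (n m : nat) (A : 'M[R]_n) (B : 'M[R]_(n, m))
    (C : 'M[R]_n) (D : 'M[R]_(n, m)) (K : 'M[R]_(m, n)) (Z : 'M[R]_n) :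
    'M[R]_n :=
  (A - B *m K) *m Z + Z *m (A - B *m K)^T
  + (C - D *m K) *m Z *m (C - D *m K)^T.

Definition shiftedA (R : realType) (n m : nat) (A : 'M[R]_n) (B : 'M[R]_(n, m))
    (rbar : R) (K : 'M[R]_(m, n)) (c : R) : 'M[R]_n :=
  A - (rbar / 2)%:M + c%:M - B *m K.

Definition opLa (R : realType) (n m : nat) (A : 'M[R]_n) (B : 'M[R]_(n, m))
    (C : 'M[R]_n) (D : 'M[R]_(n, m)) (rbar : R) (K : 'M[R]_(m, n)) (c : R)
    (Z : 'M[R]_n) : 'M[R]_n :=
  shiftedA A B rbar K c *m Z + Z *m (shiftedA A B rbar K c)^T
  + (C - D *m K) *m Z *m (C - D *m K)^T.

Definition Kms (R : realType) (n m : nat) (A : 'M[R]_n) (B : 'M[R]_(n, m))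
    (C : 'M[R]_n) (D : 'M[R]_(n, m)) : set 'M[R]_(m, n) :=
  [set K | spectral_abscissa (opL A B C D K) < 0].

(* Main.v *)
From HB Require Import structures.
Require Import Defs.
From mathcomp Require Import all_boot all_order all_algebra.
From mathcomp Require Import complex ring lra.
From mathcomp Require Import boolp classical_sets reals.
From mathcomp Require Import topology normedtype derive realfun.

Set Implicit Arguments.
Unset Strict Implicit.
Unset Printing Implicit Defensive.

Import Order.TTheory GRing.Theory Num.Theory.
Import numFieldNormedType.Exports.

Local Open Scope classical_set_scope.
Local Open Scope ring_scope.

(** Write [L Z = A Z + Z A^T + G Z G^T] and [L*] for its adjoint for the trace
    pairing. Everything rests on a Lyapunov theorem, obtained without the
    semigroup [exp (t L)] from one remark: if [T >= 0] and [T v = 0], then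
    [v^T L*(T) v = (G v)^T T (G v) >= 0].

    If [P > 0] and [L*(P) < 0], then [Re l < 0] for every eigenvalue [l] of
    [L]. Indeed [L* W = l W] for some complex symmetric [W <> 0]. Maximize
    [|v^T W v| / v^T P v] at [v0], with value [t], and rotate [W] so that
    [v0^T W v0 > 0]; the remark applied to [T = t P - Re W] at [v0] gives
    [Re l * v0^T P v0 <= v0^T L*(P) v0].

    Conversely, if [s(L) < 0], then [L*(P) < 0] forces [P > 0]. By the remark
    it suffices to find one [S > 0] with [L*(S) < 0]. Let [mu0] be the
    infimum of the [mu >= 0] such that [L*(S) < mu S] for some [S > 0]. Since
    [mu0] is not an eigenvalue, [(mu0 - L* )(P) = 1] is solvable; comparison with
    the resolvent at [mu] slightly above [mu0] gives [P > 0], and then [P]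
    itself shows that [mu0 > 0] would not be the infimum.

    Along the iteration, completing the square in the gain gives
    [L*_{k+1}(P_k) <= - Qa] for the operator at [(K_{k+1}, c_k)], and the step
    length is such that [2 alpha_{k+1} P_k < Qa]. *)

(** * Quadratic forms *)

Definition qform (R : pzRingType) (n : nat) (M : 'M[R]_n) (v : 'cV[R]_n) : R :=
  (v^T *m M *m v) ord0 ord0.

Section QuadraticForms.
Context {R : realFieldType} {n : nat}.
Implicit Types (M N P : 'M[R]_n) (v w : 'cV[R]_n) (a : R).

Lemma qformD M N v : qform (M + N) v = qform M v + qform N v.
Proof. by rewrite /qform mulmxDr mulmxDl mxE. Qed.

Lemma qformN M v : qform (- M) v = - qform M v.
Proof. by rewrite /qform mulmxN mulNmx mxE. Qed.

Lemma qformB M N v : qform (M - N) v = qform M v - qform N v.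
Proof. by rewrite qformD qformN. Qed.

Lemma qformZ a M v : qform (a *: M) v = a * qform M v.
Proof. by rewrite /qform -scalemxAr -scalemxAl mxE. Qed.

Lemma qform_0l v : qform 0 v = 0.
Proof. by rewrite /qform mulmx0 mul0mx mxE. Qed.

Lemma qform_0 M : qform M 0 = 0.
Proof. by rewrite /qform mulmx0 mxE. Qed.

Lemma qform_scale a M v : qform M (a *: v) = a ^+ 2 * qform M v.
Proof.
by rewrite /qform [(a *: v)^T]linearZ /= -!scalemxAl -scalemxAr !mxE mulrA.
Qed.

Lemma qform_conj (p : nat) (M : 'M[R]_p) (G : 'M[R]_(p, n)) v :
  qform (G^T *m M *m G) v = qform M (G *m v).
Proof. by rewrite /qform trmx_mul !mulmxA. Qed.

Lemma qform1_ge0 v : 0 <= qform 1%:M v.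
Proof.
rewrite /qform mulmx1 mxE; apply: sumr_ge0 => i _.
by rewrite mxE -expr2 sqr_ge0.
Qed.

Lemma qform1_gt0 v : v != 0 -> 0 < qform 1%:M v.
Proof.
move=> v_neq0; rewrite lt0r qform1_ge0 andbT.
apply: contraNneq v_neq0; rewrite /qform mulmx1 mxE => /eqP.
rewrite psumr_eq0 => [/allP v0|i _]; last by rewrite mxE -expr2 sqr_ge0.
apply/eqP/colP => i; apply/eqP; rewrite [X in _ == X]mxE.
by have := v0 i (mem_index_enum i); rewrite mxE -expr2 sqrf_eq0.
Qed.

Lemma sym_bilin M v w : M^T = M ->
  (v^T *m M *m w) ord0 ord0 = (w^T *m M *m v) ord0 ord0.
Proof.
move=> M_sym; transitivity ((v^T *m M *m w)^T ord0 ord0); first by rewrite [RHS]mxE.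
by rewrite !trmx_mul trmxK M_sym mulmxA.
Qed.

Lemma qform_add M v w : M^T = M ->
  qform M (v + w) = qform M v + 2 * (v^T *m M *m w) ord0 ord0 + qform M w.
Proof.
move=> M_sym; rewrite /qform [(v + w)^T]linearD /= !mulmxDl !mulmxDr.
have mxD (X Y : 'M[R]_1) : (X + Y) ord0 ord0 = X ord0 ord0 + Y ord0 ord0.
  by rewrite mxE.
by rewrite !mxD (sym_bilin w v) // mulr_natl mulr2n !addrA.
Qed.

Lemma mx_bilin_eq0 (p : nat) (u : 'cV[R]_p) :
  (forall w : 'cV[R]_p, (w^T *m u) ord0 ord0 = 0) -> u = 0.
Proof.
move=> u0; apply/colP => i; rewrite mxE.
by have := u0 (delta_mx i 0); rewrite trmx_delta -rowE mxE.
Qed.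

Lemma qform_eq0 M : M^T = M -> (forall v, qform M v = 0) -> M = 0.
Proof.
move=> M_sym M0; have Mv v : M *m v = 0.
  apply: mx_bilin_eq0 => w; rewrite mulmxA.
  have := qform_add w v M_sym; rewrite !M0; lra.
by apply/matrixP => i j; have /colP/(_ i) := Mv (delta_mx j 0); rewrite -colE !mxE.
Qed.

(* Minimality of the form at [v] along the lines [v + s w]. *)
Lemma psd_ker M v : M^T = M -> (forall w, 0 <= qform M w) ->
  qform M v = 0 -> M *m v = 0.
Proof.
move=> M_sym M_ge0 Mv0; apply: mx_bilin_eq0 => w; rewrite mulmxA.
pose b : R := (w^T *m M *m v) ord0 ord0; rewrite -/b.
have bE s : 0 <= 2 * s * b + s ^+ 2 * qform M w.
  have := M_ge0 (s *: w + v); rewrite qform_add // qform_scale Mv0 addr0.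
  by rewrite [(s *: w)^T]linearZ /= -!scalemxAl mxE -/b addrC mulrA.
(* The parabola in [bE] is least at [- b / q]; the added 1 keeps the denominator positive when [q]
   vanishes, and the value is still a negative multiple of [b ^+ 2]. *)
have := bE (- b / (1 + qform M w)); have := M_ge0 w; set q := qform M w => q_ge0.
have q1_gt0 : 0 < 1 + q by lra.
rewrite (_ : _ + _ = - (b ^+ 2 * ((2 + q) / (1 + q) ^+ 2))); last first.
  by field; rewrite gt_eqF.
rewrite oppr_ge0 pmulr_lle0; last by rewrite divr_gt0 ?exprn_gt0 //; lra.
by move=> b_le0; apply/eqP; rewrite -sqrf_eq0 eq_le b_le0 sqr_ge0.
Qed.

End QuadraticForms.

(** * Maximization of homogeneous quotients *)

Section Rayleigh.
Context {R : realType} {n : nat}.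

Lemma posdef_ge0 (P : 'M[R]_n) (v : 'cV[R]_n) : posdef P -> 0 <= qform P v.
Proof.
move=> [_ P_gt0]; have [->|/P_gt0/ltW//] := eqVneq v 0.
by rewrite qform_0.
Qed.

Lemma continuous_qform (M : 'M[R]_n) : continuous (fun v : 'rV[R]_n => qform M v^T).
Proof.
move=> v; rewrite /qform.
have -> : (fun v : 'rV[R]_n => (v^T^T *m M *m v^T) ord0 ord0) =
  (fun v : 'rV[R]_n => \sum_j (\sum_i v ord0 i * M i j) * v ord0 j).
  apply/funext => w; rewrite mxE; apply: eq_bigr => j _.
  by rewrite !mxE; congr (_ * _); apply: eq_bigr => i _; rewrite !mxE.
apply: continuous_big => [|j _]; first exact: add_continuous.
move=> {}v; apply: continuousM; last exact: coord_continuous.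
move: v; apply: continuous_big => [|i _]; first exact: add_continuous.
by move=> v; apply: continuousM; [exact: coord_continuous|exact: cst_continuous].
Qed.

Lemma compact_sphere : compact [set v : 'rV[R]_n | `|v| = 1].
Proof.
apply: bounded_closed_compact.
  by exists 1; split => // x x1 v /= ->; exact: ltW.
have -> : [set v : 'rV[R]_n | `|v| = 1] = (fun v : 'rV[R]_n => `|v|) @^-1` [set (1 : R)] by [].
apply: preimage_closed; first by move=> v _; exact: norm_continuous.
exact: closed_eq.
Qed.

(** The quotient of [f] by the power of [qform P] has degree zero, so its maximum over the compact
    unit sphere is global; cross-multiplying admits [v = 0]. The case [k = 0] serves quadratic
    forms, [k = 1] the quartic [|v^T W v|^2]. *)
Lemma rayleigh_max (P : 'M[R]_n) (k : nat) (f : 'cV[R]_n -> R) :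
  (0 < n)%N -> posdef P -> continuous (fun v : 'rV[R]_n => f v^T) ->
  (forall a v, f (a *: v) = a ^+ k.+1.*2 * f v) ->
  exists2 v0, v0 != 0 &
    forall v, f v * qform P v0 ^+ k.+1 <= f v0 * qform P v ^+ k.+1.
Proof.
move=> n_gt0 P_pd f_cont f_hom.
pose S := [set v : 'rV[R]_n | `|v| = 1].
pose h (v : 'rV[R]_n) := f v^T / qform P v^T ^+ k.+1.
have unit_scale (v : 'rV[R]_n) : v != 0 -> S (`|v|^-1 *: v).
  by move=> v0; rewrite /S /= normrZ normfV normr_id mulVf // normr_eq0.
have S_neq0 (v : 'rV[R]_n) : S v -> v^T != 0.
  rewrite /S /= trmx_eq0 => v1; apply/eqP => v0.
  by move: v1; rewrite v0 normr0 => /eqP; rewrite eq_sym oner_eq0.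
have S_nonempty : S !=set0.
  exists (`|const_mx 1 : 'rV[R]_n|^-1 *: const_mx 1); apply: unit_scale.
  apply/eqP => /rowP/(_ (Ordinal n_gt0)) /eqP.
  by rewrite !mxE oner_eq0.
have h_cont_at (v : 'rV[R]_n) : v^T != 0 -> {for v, continuous h}.
  move=> v0; apply: continuousM; first exact: f_cont.
  apply: continuousV; first by rewrite expf_neq0 // gt_eqF //; apply: P_pd.2.
  exact: (continuous_comp (@continuous_qform P v) (@exprn_continuous R k.+1 _)).
have h_cont : {within S, continuous h}.
  by apply: continuous_in_subspaceT => v /set_mem /S_neq0 /h_cont_at.
have [u uS u_max] := EVT_max_rV S_nonempty compact_sphere h_cont.
move: uS; rewrite inE => /S_neq0 u0; exists u^T => // v.
have [->|v0] := eqVneq v 0.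
  have f0 : f 0 = 0 by have := f_hom 0 0; rewrite scale0r expr0n /= mul0r.
  by rewrite f0 qform_0 expr0n /= mul0r mulr0.
have vT0 : v^T != 0 by rewrite trmx_eq0.
have := u_max (`|v^T|^-1 *: v^T); rewrite inE => /(_ (unit_scale _ vT0)).
rewrite /h linearZ /= trmxK f_hom qform_scale exprMn -exprM mul2n.
have a0 : `|v^T|^-1 ^+ k.+1.*2 != 0 by rewrite expf_neq0 // invr_neq0 // normr_eq0.
rewrite -mulf_div divff // mul1r.
by rewrite ler_pdivrMr ?exprn_gt0 ?P_pd.2 // mulrAC ler_pdivlMr ?exprn_gt0 ?P_pd.2.
Qed.

End Rayleigh.

(** * Lyapunov operators on symmetric matrices *)

(** Common shape of [opL] and [opLa]. The general ring allows [R[i]] as well, with the plain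
    transpose as in [spectrum]. *)
Definition lyap (F : comNzRingType) (n : nat) (A G Z : 'M[F]_n) : 'M[F]_n :=
  A *m Z + Z *m A^T + G *m Z *m G^T.

Section LyapunovOperator.
Context {F : numFieldType} {n : nat}.
Implicit Types (A G Z W : 'M[F]_n) (a l : F).

Lemma lyap_is_linear A G : linear (lyap A G).
Proof.
move=> a Z W; rewrite /lyap !mulmxDr !mulmxDl -!scalemxAr -!scalemxAl !scalerDr.
by rewrite [RHS]addrACA; congr (_ + _); rewrite addrACA.
Qed.

HB.instance Definition _ A G :=
  GRing.isLinear.Build F 'M[F]_n 'M[F]_n *:%R (lyap A G) (lyap_is_linear A G).

Lemma lyapD A G Z W : lyap A G (Z + W) = lyap A G Z + lyap A G W.
Proof. by have := lyap_is_linear A G 1 Z W; rewrite !scale1r. Qed.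

Lemma lyap0 A G : lyap A G 0 = 0.
Proof. by rewrite /lyap !mulmx0 !mul0mx !addr0. Qed.

Lemma lyapZ A G a Z : lyap A G (a *: Z) = a *: lyap A G Z.
Proof. by have := lyap_is_linear A G a Z 0; rewrite lyap0 !addr0. Qed.

Lemma lyapN A G Z : lyap A G (- Z) = - lyap A G Z.
Proof. by rewrite -scaleN1r lyapZ scaleN1r. Qed.

Lemma lyapB A G Z W : lyap A G (Z - W) = lyap A G Z - lyap A G W.
Proof. by rewrite lyapD lyapN. Qed.

Lemma lyap_tr A G Z : (lyap A G Z)^T = lyap A G Z^T.
Proof.
by rewrite /lyap !linearD /= !trmx_mul !trmxK mulmxA; congr (_ + _); rewrite addrC.
Qed.

Lemma lyap_shift A G a Z :
  lyap (A + a%:M) G Z = lyap A G Z + (2 * a) *: Z.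
Proof.
rewrite /lyap linearD /= tr_scalar_mx mulmxDl mulmxDr mul_scalar_mx mul_mx_scalar.
by rewrite mulr_natl mulr2n scalerDl -[RHS]addrAC; congr (_ + _); rewrite addrACA.
Qed.

(** Half of [l] goes to each side of [Z], so an eigenvalue equation is a kernel equation for an
    operator of the same form. *)
Lemma lyap_eigen A G l Z :
  (lyap A G Z == l *: Z) = (lyap (A - (l / 2)%:M) G Z == 0).
Proof.
rewrite -raddfN /= lyap_shift mulrN mulrCA divff ?pnatr_eq0 // mulr1 scaleNr.
by rewrite subr_eq0.
Qed.

Lemma lyap_adjoint A G Z W :
  \tr (lyap A G Z *m W) = \tr (Z *m lyap A^T G^T W).
Proof.
rewrite /lyap !trmxK !mulmxDl !mulmxDr !raddfD /= [_ + \tr (Z *m A^T *m W)]addrC.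
congr (_ + _ + _); first by rewrite mulmxA.
  by rewrite mxtrace_mulC !mulmxA mxtrace_mulC mulmxA.
by rewrite -!mulmxA mxtrace_mulC !mulmxA.
Qed.

(* The map [T] below agrees with [2 lyap A G] on symmetric matrices and with
   twice the identity on skew-symmetric ones. *)
Lemma lyap_sym_surj A G :
  (forall Z, Z^T = Z -> lyap A G Z = 0 -> Z = 0) ->
  forall W, W^T = W -> exists2 Z, Z^T = Z & lyap A G Z = W.
Proof.
move=> inj W W_sym.
pose T Z := lyap A G (Z + Z^T) + (Z - Z^T).
have T_lin : linear T.
  move=> a Z V; rewrite /T [(a *: Z + V)^T]linearP /=.
  have -> : a *: Z + V + (a *: Z^T + V^T) = a *: (Z + Z^T) + (V + V^T).
    by rewrite addrACA scalerDr.
  have -> : a *: Z + V - (a *: Z^T + V^T) = a *: (Z - Z^T) + (V - V^T).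
    by rewrite opprD addrACA scalerBr.
  by rewrite (lyapD _ _ (a *: _)) lyapZ [LHS]addrACA -scalerDr.
pose Tl : {linear 'M[F]_n -> 'M[F]_n} :=
  HB.pack T (GRing.isLinear.Build F 'M[F]_n 'M[F]_n *:%R T T_lin).
have sym2 Z : (Z + Z^T)^T = Z + Z^T by rewrite linearD /= trmxK addrC.
(* The first summand of [T Z] is symmetric and the second skew-symmetric, so comparison with the
   transpose kills the latter. *)
have skew0 Z V : V^T = V -> T Z = V -> Z - Z^T = 0.
  move=> V_sym TZ; have := V_sym; rewrite -TZ /T linearD /= lyap_tr sym2.
  rewrite linearB /= trmxK => /addrI /esym/eqP.
  rewrite -[Z^T - Z]opprB -subr_eq0 opprK -mulr2n -scaler_nat scaler_eq0.
  by rewrite pnatr_eq0 => /eqP.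
have Tl_inj : lker (linfun Tl) == 0%VS.
  apply/lker0P => Z V; rewrite !lfunE /= => /eqP; rewrite -subr_eq0.
  have -> : T Z - T V = T (Z - V) by rewrite -[T](_ : Tl = _ :> (_ -> _)) // linearB.
  move=> /eqP TX; have XX := skew0 (Z - V) 0 (trmx0 _ _ _) TX.
  move: TX; rewrite /T XX addr0 => /(inj _ (sym2 _)) X2.
  have : Z - V + (Z - V)^T + (Z - V - (Z - V)^T) = 0 by rewrite X2 XX addr0.
  rewrite addrACA subrr addr0 -mulr2n -scaler_nat => /eqP.
  by rewrite scaler_eq0 pnatr_eq0 /= subr_eq0 => /eqP.
have [Z TZ] : exists Z, T Z = W.
  have : W \in limg (linfun Tl) by rewrite lker0_limgf ?memvf.
  by case/memv_imgP => Z _; rewrite lfunE /= => ->; exists Z.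
have Z_sym := skew0 _ _ W_sym TZ.
by exists (Z + Z^T); [exact: sym2|move: TZ; rewrite /T Z_sym addr0].
Qed.

(** By surjectivity, a kernel element of the adjoint is trace-orthogonal to every symmetric matrix;
    pairing with symmetrized elementary matrices reads off its entries. *)
Lemma lyap_adjoint_inj A G :
  (forall Z, Z^T = Z -> lyap A G Z = 0 -> Z = 0) ->
  forall Z, Z^T = Z -> lyap A^T G^T Z = 0 -> Z = 0.
Proof.
move=> inj Z Z_sym LZ; apply/matrixP => i j.
have D_sym : (delta_mx i j + delta_mx j i : 'M[F]_n)^T = delta_mx i j + delta_mx j i.
  by rewrite linearD /= !trmx_delta addrC.
have [Y _ LY] := lyap_sym_surj inj D_sym.
have := lyap_adjoint A G Y Z; rewrite LZ mulmx0 mxtrace0 LY mulmxDl mxtraceD.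
have tr_delta (k l : 'I_n) : \tr (delta_mx k l *m Z) = Z l k.
  rewrite /mxtrace (bigD1 k) //= big1 ?addr0 => [|r rk]; rewrite mxE; last first.
    by apply: big1 => q _; rewrite mxE (negPf rk) mul0r.
  rewrite (bigD1 l) //= big1 ?addr0 => [|q ql]; rewrite mxE ?eqxx ?mul1r //.
  by rewrite (negPf ql) andbF mul0r.
rewrite !tr_delta -{1}Z_sym mxE -mulr2n -mulr_natl => /eqP.
by rewrite mulf_eq0 pnatr_eq0 /= => /eqP ->; rewrite mxE.
Qed.

End LyapunovOperator.

(** * Spectrum and spectral abscissa *)

Section Spectrum.
Context {R : realType} {n : nat}.
Implicit Types (A G Z : 'M[R]_n) (l : R[i]).

Local Notation cmx := (map_mx (real_complex R)).

Lemma complexify_lyap A G (Z : 'M[R[i]]_n) :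
  complexify (lyap A G) Z = lyap (cmx A) (cmx G) Z.
Proof.
have decomp (X Y : 'M[R]_n) :
  \matrix_(j, k) (Complex (X j k) (Y j k)) = cmx X + 'i%C *: cmx Y.
  by apply/matrixP => j k; rewrite !mxE; simpc.
have -> : complexify (lyap A G) Z = cmx (lyap A G (map_mx (@complex.Re R) Z))
    + 'i%C *: cmx (lyap A G (map_mx (@complex.Im R) Z)) by rewrite -decomp.
have cmx_lyap X : cmx (lyap A G X) = lyap (cmx A) (cmx G) (cmx X).
  by rewrite /lyap !map_mxD !map_mxM !map_trmx.
rewrite !cmx_lyap -lyapZ -lyapD -decomp; congr lyap.
by apply/matrixP => j k; rewrite !mxE; case: (Z j k).
Qed.

Lemma spectrum_lyapP A G l : spectrum (lyap A G) l <->
  exists Z : 'M[R[i]]_n,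
    [/\ Z^T = Z, Z != 0 & lyap (cmx A - (l / 2)%:M) (cmx G) Z = 0].
Proof.
split=> -[Z [Z_sym Z0 LZ]]; exists Z; split=> //; apply/eqP.
  by rewrite -lyap_eigen -complexify_lyap LZ.
by rewrite complexify_lyap lyap_eigen LZ.
Qed.

(** If [l] were not an eigenvalue of the adjoint, the shifted adjoint would be injective on
    symmetric matrices, and so would its own adjoint, which is the shifted original. *)
Lemma spectrum_adjoint A G l :
  spectrum (lyap A G) l -> spectrum (lyap A^T G^T) l.
Proof.
move=> /spectrum_lyapP [Z [Z_sym Z0 LZ]]; apply: contrapT => l_notin.
move/negP: Z0; apply; apply/eqP.
have AE : (cmx A - (l / 2)%:M)^T = cmx A^T - (l / 2)%:M.
  by rewrite [LHS]raddfB /= tr_scalar_mx map_trmx.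
have inj W : W^T = W -> lyap (cmx A - (l / 2)%:M)^T (cmx G)^T W = 0 -> W = 0.
  move=> W_sym LW; apply: contrapT => /eqP W0; apply: l_notin.
  apply/spectrum_lyapP; exists W; split; [exact: W_sym|exact: W0|].
  by rewrite -AE -map_trmx.
have LZ' : lyap (cmx A - (l / 2)%:M)^T^T (cmx G)^T^T Z = 0 by rewrite !trmxK.
exact: (lyap_adjoint_inj inj Z_sym LZ').
Qed.

(** Eigenmatrices must be symmetric, so an eigenvector is sought in the row space of [V], the matrix
    of [Z |-> Z + Z^T]. This space is stable because the operator commutes with transposition; [C]
    is the matrix of the restriction in the basis [W]. *)
Lemma spectrum_nonempty A G : (0 < n)%N -> spectrum (lyap A G) !=set0.
Proof.
move=> n_gt0.
pose L : {linear 'M[R[i]]_n -> 'M[R[i]]_n} := lyap (cmx A) (cmx G).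
pose T : {linear 'M[R[i]]_n -> 'M[R[i]]_n} := (@idfun 'M[R[i]]_n \+ @trmx R[i] n n).
pose M := lin_mx L; pose V := lin_mx T.
have TE (Z : 'M[R[i]]_n) : T Z = Z + Z^T by [].
have V_stable : stablemx V M.
  suff -> : V *m M = M *m V by exact: submxMl.
  apply/row_matrixP => i; rewrite !rowE !mulmxA.
  set u := delta_mx _ _; rewrite -[u]vec_mxK !mul_vec_lin.
  by rewrite !TE [L (_ + _)]lyapD -lyap_tr.
have V_neq0 : V != 0.
  apply/eqP => V0; have := mul_vec_lin T 1%:M; rewrite -/V V0 mulmx0 TE trmx1.
  move=> /esym/(canRL mxvecK); rewrite linear0.
  move=> /matrixP /(_ (Ordinal n_gt0) (Ordinal n_gt0)).
  by rewrite !mxE eqxx -mulr2n => /eqP; rewrite pnatr_eq0.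
have rank_gt0 : (0 < \rank V)%N by rewrite lt0n mxrank_eq0.
pose W := row_base V.
have W_stable : (W *m M <= W)%MS.
  by rewrite (eqmxMr _ (eq_row_base V)) (eq_row_base V).
have [C WM] := submxP W_stable.
have [u u0] : exists2 u : 'rV_(\rank V), u != 0 & stablemx u C.
  have [|u u0 /=] := @common_eigenvector _ _ [:: C] rank_gt0; last first.
    by rewrite andbT; exists u.
  by move=> X Y; rewrite !inE => /eqP -> /eqP ->.
move=> /sub_rVP [l uC].
have uW : u *m W != 0.
  by apply: contra u0 => /eqP uW0; rewrite -(mulmx_free_eq0 u (row_base_free V)) uW0.
exists l; exists (vec_mx (u *m W)); split.
- have : (u *m W <= V)%MS by rewrite -(eq_row_base V) submxMl.
  case/submxP => x ->; rewrite -[x]vec_mxK mul_vec_lin mxvecK TE /symmx.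
  by rewrite linearD /= trmxK addrC.
- by apply: contra uW => /eqP uW0; rewrite -[u *m W]vec_mxK uW0 linear0.
rewrite complexify_lyap -[LHS]/(L _); apply: (can_inj mxvecK).
rewrite -mul_vec_lin vec_mxK -mulmxA -/M WM mulmxA uC -scalemxAl linearZ /=.
by rewrite vec_mxK.
Qed.

Lemma spectrum_finite A G : exists s : seq R[i], forall l, spectrum (lyap A G) l -> l \in s.
Proof.
pose L : {linear 'M[R[i]]_n -> 'M[R[i]]_n} := lyap (cmx A) (cmx G).
have [s sE] := closed_field_poly_normal (char_poly (lin_mx L)).
exists s => l [Z [_ Z0 LZ]].
have : eigenvalue (lin_mx L) l.
  apply/eigenvalueP; exists (mxvec Z); last first.
    by apply: contra Z0 => /eqP Z0; rewrite -[Z]mxvecK Z0 linear0.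
  by rewrite mul_vec_lin -linearZ /= -LZ complexify_lyap.
by rewrite eigenvalue_root_char sE (monicP (char_poly_monic _)) scale1r root_prod_XsubC.
Qed.

Lemma seq_max_exists (s : seq R) (S : set R) :
  S !=set0 -> (forall x, S x -> x \in s) -> exists x, S x /\ ubound S x.
Proof.
elim: s S => [|y s IHs] S [z Sz] S_s; first by have := S_s z Sz.
pose S' := [set x | S x /\ y < x].
have [[t S't]|S'0] := pselect (S' !=set0).
  have [|x [[Sx yx] x_ub]] := IHs S' (ex_intro _ t S't).
    move=> x [Sx yx]; have := S_s x Sx; rewrite inE => /orP[/eqP xy|//].
    by rewrite xy ltxx in yx.
  exists x; split=> // w Sw; have [/le_trans-> //|yw] := leP w y; first exact: ltW.
  exact: x_ub.
have y_ub w : S w -> w <= y.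
  by move=> Sw; rewrite leNgt; apply/negP => yw; apply: S'0; exists w.
have [Sy|nSy] := pselect (S y); first by exists y; split.
apply: IHs; first by exists z.
move=> x Sx; have := S_s x Sx; rewrite inE => /orP[/eqP xy|//].
by rewrite xy in Sx.
Qed.

Lemma set_maxP (S : set R) (x : R) : S x -> ubound S x -> set_max S = x.
Proof.
move=> Sx x_ub; rewrite /set_max; case: xgetP => [y _ [Sy y_ub]|/(_ x)[]//].
by apply/eqP; rewrite eq_le x_ub // y_ub.
Qed.

Lemma set_minP (S : set R) (x : R) : S x -> lbound S x -> set_min S = x.
Proof.
move=> Sx x_lb; rewrite /set_min; case: xgetP => [y _ [Sy y_lb]|/(_ x)[]//].
by apply/eqP; rewrite eq_le y_lb // x_lb.
Qed.

(** The spectrum is finite and nonempty, so [set_max] is an attained maximum and not its default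
    value. *)
Lemma spectral_abscissaP A G : (0 < n)%N ->
  (exists2 l, spectrum (lyap A G) l & complex.Re l = spectral_abscissa (lyap A G))
  /\ forall l, spectrum (lyap A G) l -> complex.Re l <= spectral_abscissa (lyap A G).
Proof.
move=> n_gt0; have [s s_spec] := spectrum_finite A G.
have [l0 l0_spec] := spectrum_nonempty A G n_gt0.
have [||x [[l l_spec lx] x_ub]] :=
    @seq_max_exists [seq complex.Re l | l <- s] [set complex.Re l | l in spectrum (lyap A G)].
- by exists (complex.Re l0), l0.
- by move=> x [l /s_spec ls <-]; exact: map_f.
have -> : spectral_abscissa (lyap A G) = x by apply: set_maxP => //; exists l.
by split=> [|k k_spec]; [exists l|apply: x_ub; exists k].
Qed.

Lemma spectrum_shift A G a l :
  spectrum (lyap A G) l -> spectrum (lyap (A + a%:M) G) (l + (2 * a)%:C%C).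
Proof.
move=> [Z [Z_sym Z0 LZ]]; exists Z; split=> //.
move: LZ; rewrite !complexify_lyap map_mxD map_scalar_mx lyap_shift => ->.
by rewrite scalerDl rmorphM rmorph_nat.
Qed.

Lemma spectral_abscissa_shift A G a : (0 < n)%N ->
  spectral_abscissa (lyap (A + a%:M) G) = spectral_abscissa (lyap A G) + 2 * a.
Proof.
move=> n_gt0; have [[l l_spec lE] l_max] := spectral_abscissaP A G n_gt0.
apply: set_maxP => [|_ [k k_spec <-]].
  by exists (l + (2 * a)%:C%C); [exact: spectrum_shift|rewrite raddfD /= lE].
(* The opposite shift carries an eigenvalue of the shifted operator back to the original one. *)
have := spectrum_shift (- a) k_spec; rewrite raddfN /= addrK => /l_max.
by rewrite raddfD /= mulrN -lerBrDr opprK.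
Qed.

End Spectrum.

(** * The Lyapunov theorem *)

Section LyapunovTheorem.
Context {R : realType} {n : nat} (n_gt0 : (0 < n)%N).
Implicit Types (A G M P S T U V : 'M[R]_n) (v : 'cV[R]_n).

Lemma rayleigh_quotient M P : posdef P ->
  exists t, (exists2 v0, v0 != 0 & qform M v0 = t * qform P v0) /\
    forall v, qform M v <= t * qform P v.
Proof.
move=> P_pd; have [||v0 v00 v0_max] := @rayleigh_max _ _ P 0 (qform M) n_gt0 P_pd.
- exact: continuous_qform.
- by move=> a v; rewrite qform_scale.
have Pv0 : 0 < qform P v0 by apply: P_pd.2.
exists (qform M v0 / qform P v0); split.
  by exists v0 => //; rewrite mulfVK ?gt_eqF.
by move=> v; rewrite mulrAC ler_pdivlMr //; have := v0_max v; rewrite !expr1.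
Qed.

Lemma lyap_psd_ker A G T v : T^T = T -> (forall w, 0 <= qform T w) ->
  qform T v = 0 -> 0 <= qform (lyap A G T) v.
Proof.
move=> T_sym T_ge0 Tv0; have Tv := psd_ker T_sym T_ge0 Tv0.
have vT : v^T *m T = 0 by rewrite -[T]T_sym -trmx_mul Tv trmx0.
have -> : lyap A G T = A *m T + T *m A^T + G^T^T *m T *m G^T by rewrite trmxK.
have AT0 : qform (A *m T) v = 0 by rewrite /qform -!mulmxA Tv !mulmx0 mxE.
have TA0 : qform (T *m A^T) v = 0 by rewrite /qform mulmxA vT !mul0mx mxE.
by rewrite !qformD qform_conj AT0 TA0 !add0r.
Qed.

(** Here [t] is the least number with [t S + P >= 0], and this matrix has form zero at [v0]. By
    [lyap_psd_ker] its image is nonnegative there, so the sign of [lyap A G P] at [v0] controls the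
    sign of [t]. *)
Lemma lyap_compare A G S P : posdef S -> P^T = P ->
  (forall v, v != 0 -> qform (lyap A G S) v < 0) ->
  exists t, (forall v, - t * qform S v <= qform P v) /\
    exists2 v0, v0 != 0 & exists2 s, 0 < s & t * s <= qform (lyap A G P) v0.
Proof.
move=> S_pd P_sym S_lt0.
have [t [[v0 v00 v0E] t_max]] := rayleigh_quotient (- P) S_pd.
exists t; split=> [v|]; first by have := t_max v; rewrite qformN mulNr lerNl.
exists v0 => //; exists (- qform (lyap A G S) v0); first by rewrite oppr_gt0 S_lt0.
have T_sym : (t *: S + P)^T = t *: S + P by rewrite linearD linearZ /= S_pd.1 P_sym.
have T_ge0 w : 0 <= qform (t *: S + P) w.
  by have := t_max w; rewrite qformN qformD qformZ; lra.
have := @lyap_psd_ker A G _ v0 T_sym T_ge0.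
rewrite lyapD lyapZ !(qformD (t *: _)) !qformZ -v0E qformN addNr => /(_ erefl); lra.
Qed.

Lemma lyap_compare_ge0 A G S P : posdef S -> P^T = P ->
  (forall v, v != 0 -> qform (lyap A G S) v < 0) ->
  (forall v, qform (lyap A G P) v <= 0) -> forall v, 0 <= qform P v.
Proof.
move=> S_pd P_sym S_lt0 P_le0 v.
have [t [t_le [v0 v00 [s s_gt0 ts]]]] := lyap_compare S_pd P_sym S_lt0.
have := t_le v; have := posdef_ge0 v S_pd; have := P_le0 v0; nra.
Qed.

Lemma lyap_compare_posdef A G S P : posdef S -> P^T = P ->
  (forall v, v != 0 -> qform (lyap A G S) v < 0) ->
  (forall v, v != 0 -> qform (lyap A G P) v < 0) -> posdef P.
Proof.
move=> S_pd P_sym S_lt0 P_lt0; split=> // v v0; rewrite -/(qform P v).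
have [t [t_le [v1 v10 [s s_gt0 ts]]]] := lyap_compare S_pd P_sym S_lt0.
have := t_le v; have := S_pd.2 v v0; rewrite -/(qform S v); have := P_lt0 v1 v10; nra.
Qed.

Lemma posdef1 : posdef (1%:M : 'M[R]_n).
Proof. by split=> [|v /qform1_gt0 //]; rewrite /symmx trmx1. Qed.

Lemma lyap_stable_posdef A G :
  (forall mu Z, 0 <= mu -> Z^T = Z -> lyap A G Z = mu *: Z -> Z = 0) ->
  exists2 S, posdef S & forall v, v != 0 -> qform (lyap A G S) v < 0.
Proof.
move=> no_eig.
pose E := [set mu : R | 0 <= mu /\ exists2 S, posdef S &
  forall v, v != 0 -> qform (lyap (A - (mu / 2)%:M) G S) v < 0].
have shiftE mu S : lyap (A - (mu / 2)%:M) G S = lyap A G S - mu *: S.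
  by rewrite -raddfN /= lyap_shift mulrN mulrC divfK ?pnatr_eq0 // scaleNr.
have E_nonempty : E !=set0.
  (* The identity is a witness as soon as [mu] exceeds the largest quotient [t] of its image. *)
  have [t [_ t_max]] := rayleigh_quotient (lyap A G 1%:M) posdef1.
  exists (Num.max 0 (t + 1)); split; first by rewrite le_max lexx.
  exists 1%:M; first exact: posdef1.
  move=> v v0; rewrite shiftE qformB qformZ.
  have := t_max v; have := qform1_gt0 v0.
  have : t + 1 <= Num.max 0 (t + 1) by rewrite le_max lexx orbT.
  nra.
have E_inf : has_inf E by split=> //; exists 0 => x [].
pose mu0 := inf E.
have mu0_ge0 : 0 <= mu0 by apply: lb_le_inf => // x [].
have resolvent mu : 0 <= mu -> exists2 P, P^T = P & lyap (A - (mu / 2)%:M) G P = - 1%:M.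
  move=> mu_ge0; apply: lyap_sym_surj => [Z Z_sym LZ|]; last by rewrite linearN /= trmx1.
  apply: (no_eig mu) => //; apply/eqP; rewrite -subr_eq0 -shiftE LZ //.
have neg1 v : v != 0 -> qform (- 1%:M) v < 0.
  by move=> v0; rewrite qformN oppr_lt0 qform1_gt0.
have [P P_sym LP] := resolvent mu0 mu0_ge0.
have P_pd : posdef P.
  have [c [_ c_max]] := rayleigh_quotient (- P) posdef1.
  pose d := Num.max 1 c.
  have [d1 dc] : 1 <= d /\ c <= d by rewrite !le_max !lexx orbT.
  have d_gt0 : 0 < d by lra.
  have [mu [mu_ge0 [S S_pd LS]] mu_lt] :
      exists2 mu, E mu & mu < mu0 + d^-1.
    by apply: inf_adherent; rewrite ?invr_gt0.
  have mu0_le : mu0 <= mu by apply: ge_inf; [case: E_inf|split=> //; exists S].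
  have [Q Q_sym LQ] := resolvent mu mu_ge0.
  have Q_pd : posdef Q.
    by apply: (lyap_compare_posdef S_pd Q_sym LS) => v; rewrite LQ; exact: neg1.
  (* Since [P >= - d], the operator shifted by [mu] maps [P] to at most [- e] times the identity,
     which is its value at [e *: Q]. Comparison gives [P >= e *: Q], and [mu < mu0 + d^-1] makes [e]
     positive. *)
  pose e := 1 - d * (mu - mu0).
  have e_gt0 : 0 < e.
    have : mu - mu0 < d^-1 by lra.
    by rewrite -(ltr_pM2l d_gt0) mulfV ?gt_eqF // /e; lra.
  have LX v : qform (lyap (A - (mu / 2)%:M) G (P - e *: Q)) v <= 0.
    rewrite lyapB lyapZ LQ shiftE.
    have -> : lyap A G P = mu0 *: P - 1%:M.
      by move: LP; rewrite shiftE => /(canRL (subrK _)); rewrite addrC.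
    rewrite !(qformB, qformD, qformN, qformZ).
    have := c_max v; rewrite qformN.
    have := qform1_ge0 v; set q := qform 1%:M v; set p := qform P v => q_ge0 pq.
    rewrite /e; have : 0 <= (mu - mu0) * (p + d * q) by apply: mulr_ge0; nra.
    nra.
  have X_sym : (P - e *: Q)^T = P - e *: Q by rewrite linearB linearZ /= P_sym Q_sym.
  have X_ge0 := lyap_compare_ge0 S_pd X_sym LS LX.
  split=> // v v0; rewrite -/(qform P v); have := X_ge0 v; rewrite qformB qformZ.
  have := Q_pd.2 v v0; rewrite -/(qform Q v); nra.
have LPE v : qform (lyap A G P) v = mu0 * qform P v - qform 1%:M v.
  have := congr1 (fun M => qform M v) LP; rewrite /= shiftE qformB qformZ qformN; lra.
have [mu0_gt0|mu0_le0] := ltP 0 mu0; last first.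
  exists P => // v v0; rewrite LPE (le_anti (introT andP (conj mu0_le0 mu0_ge0))).
  by rewrite mul0r sub0r oppr_lt0 qform1_gt0.
have [c [_ c_max]] := rayleigh_quotient P posdef1.
pose d := Num.max 1 c.
have [d1 dc] : 1 <= d /\ c <= d by rewrite !le_max !lexx orbT.
have d_gt0 : 0 < d by lra.
(* As [P <= d], lowering [mu0] by at most [d^-1 / 2] costs at most half of the identity gained from
   [P]; so [mu] lies in [E] below its infimum. *)
pose mu := Num.max 0 (mu0 - d^-1 / 2).
have dV_gt0 : 0 < d^-1 by rewrite invr_gt0.
have mu_lt : mu < mu0 by rewrite gt_max mu0_gt0 /=; lra.
have : E mu.
  split; first by rewrite le_max lexx.
  exists P => // v v0; rewrite shiftE qformB qformZ LPE.
  have : mu0 - d^-1 / 2 <= mu by rewrite le_max lexx orbT.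
  have := c_max v; have := qform1_gt0 v0; have := P_pd.2 v v0; rewrite -/(qform P v).
  set p := qform P v; set q := qform 1%:M v => p_gt0 q_gt0 pq mu_ge.
  have pd : d^-1 * p <= q by rewrite ler_pdivrMl //; nra.
  nra.
move=> /(ge_inf (proj2 E_inf)); rewrite -/mu0; lra.
Qed.

Lemma spectrum_re_lt0 A G P : posdef P ->
  (forall v, v != 0 -> qform (lyap A^T G^T P) v < 0) ->
  forall l, spectrum (lyap A G) l -> complex.Re l < 0.
Proof.
move=> P_pd LP_lt0 l /spectrum_adjoint [W [W_sym W0 LW]].
pose U := map_mx (@complex.Re R) W; pose V := map_mx (@complex.Im R) W.
pose a := complex.Re l; pose b := complex.Im l; rewrite -/a.
have lE : l = Complex a b by rewrite /a /b; case: (l).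
have U_sym : U^T = U by rewrite /U map_trmx W_sym.
have V_sym : V^T = V by rewrite /V map_trmx W_sym.
have LU : lyap A^T G^T U = a *: U - b *: V.
  apply/matrixP => i j; have /matrixP/(_ i j)/(congr1 (@complex.Re R)) := LW.
  by rewrite !mxE /= lE; case: (W i j).
have LV : lyap A^T G^T V = a *: V + b *: U.
  apply/matrixP => i j; have /matrixP/(_ i j)/(congr1 (@complex.Im R)) := LW.
  by rewrite !mxE /= lE; case: (W i j).
pose f v := qform U v ^+ 2 + qform V v ^+ 2.
have [||v0 v00 v0_max] := @rayleigh_max _ _ P 1 f n_gt0 P_pd.
- have sq_cont M : continuous (fun v : 'rV[R]_n => qform M v^T ^+ 2).
    move=> v; exact: (continuous_comp (@continuous_qform _ _ M v) (@exprn_continuous R 2 _)).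
  move=> v; exact: (continuousD (@sq_cont U v) (@sq_cont V v)).
- by move=> c v; rewrite /f !qform_scale; ring.
have p_gt0 : 0 < qform P v0 by apply: P_pd.2.
set p := qform P v0 in v0_max p_gt0; set g := f v0 in v0_max.
have g_ge0 : 0 <= g by rewrite addr_ge0 ?sqr_ge0.
have g_gt0 : 0 < g.
  rewrite lt0r g_ge0 andbT; apply: contraNneq W0 => g0.
  have f0 v : f v = 0.
    apply/eqP; rewrite eq_le addr_ge0 ?sqr_ge0 // andbT.
    by have := v0_max v; rewrite g0 mul0r pmulr_lle0 // exprn_gt0.
  have UV0 v : qform U v = 0 /\ qform V v = 0.
    have := f0 v; rewrite /f => /eqP; rewrite paddr_eq0 ?sqr_ge0 // !sqrf_eq0.
    by case/andP=> /eqP ? /eqP.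
  have U0 : U = 0 by apply: qform_eq0 => // v; case: (UV0 v).
  have V0 : V = 0 by apply: qform_eq0 => // v; case: (UV0 v).
  apply/eqP/matrixP => i j; have /matrixP/(_ i j) := U0; have /matrixP/(_ i j) := V0.
  by rewrite !mxE; case: (W i j) => x y /= -> ->.
pose x := qform U v0; pose y := qform V v0.
(* This is the matrix [t P - Re W] of the overview, [W] being rotated by the conjugate of [x + i y],
   multiplied by a positive factor that clears denominators and square roots. *)
pose T := g *: P - p *: (x *: U + y *: V).
have T_sym : T^T = T by rewrite /T linearB !linearZ linearD !linearZ /= P_pd.1 U_sym V_sym.
have T_ge0 w : 0 <= qform T w.
  rewrite /T qformB !qformZ qformD !qformZ.
  set u := qform U w; set v := qform V w.
  have pw_ge0 : 0 <= qform P w by exact: posdef_ge0.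
  (* Cauchy-Schwarz bounds [x u + y v] by the moduli of the two complex values, and maximality of
     [v0] bounds the modulus at [w]. *)
  have s_le : (p * (x * u + y * v)) ^+ 2 <= (g * qform P w) ^+ 2.
    have CS : (x * u + y * v) ^+ 2 <= g * (u ^+ 2 + v ^+ 2).
      have : 0 <= (x * v - y * u) ^+ 2 by exact: sqr_ge0.
      by rewrite /g /f -/x -/y; lra.
    rewrite exprMn; apply: (le_trans (ler_wpM2l (sqr_ge0 p) CS)).
    have -> : p ^+ 2 * (g * (u ^+ 2 + v ^+ 2)) = g * ((u ^+ 2 + v ^+ 2) * p ^+ 2) by ring.
    have -> : (g * qform P w) ^+ 2 = g * (g * qform P w ^+ 2) by ring.
    by rewrite ler_pM2l //; exact: v0_max.
  rewrite subr_ge0; apply: le_trans (ler_norm _) _.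
  rewrite -[leRHS]ger0_norm ?mulr_ge0 //.
  by rewrite -ler_sqr ?nnegrE // !real_normK ?num_real.
have T_v0 : qform T v0 = 0.
  rewrite /T qformB !qformZ qformD !qformZ -/p -/x -/y /g /f -/x -/y; ring.
have := lyap_psd_ker A^T G^T T_sym T_ge0 T_v0.
rewrite lyapB !lyapZ lyapD !lyapZ LU LV qformB !qformZ.
have := LP_lt0 v0 v00; set q := qform _ v0 => q_lt0.
(* The rotation makes the value at [v0] real, so the terms in the imaginary part [b] cancel. *)
have -> : qform (x *: (a *: U - b *: V) + y *: (a *: V + b *: U)) v0 = a * g.
  by rewrite !(qformB, qformZ, qformD) /g /f -/x -/y; ring.
have gq : g * q < 0 by rewrite pmulr_rlt0.
rewrite ltNge => le_pq; apply/negP => a_ge0.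
have : 0 <= p * (a * g) by rewrite !mulr_ge0 // ltW.
lra.
Qed.

End LyapunovTheorem.

(** * Stability criteria and extremal eigenvalues *)

Section Stability.
Context {R : realType} {n : nat} (n_gt0 : (0 < n)%N).
Implicit Types (A G M P : 'M[R]_n) (v : 'cV[R]_n).

Lemma abscissa_lt0 A G P : posdef P ->
  (forall v, v != 0 -> qform (lyap A^T G^T P) v < 0) ->
  spectral_abscissa (lyap A G) < 0.
Proof.
move=> P_pd LP; have [[l l_spec <-] _] := spectral_abscissaP A G n_gt0.
exact: (spectrum_re_lt0 n_gt0 P_pd LP).
Qed.

Lemma abscissa_lt0_posdef A G P : spectral_abscissa (lyap A G) < 0 -> P^T = P ->
  (forall v, v != 0 -> qform (lyap A^T G^T P) v < 0) -> posdef P.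
Proof.
move=> s_lt0 P_sym LP; have [_ s_max] := spectral_abscissaP A G n_gt0.
(* A real symmetric eigenmatrix is also one of the complexification, so [mu] would be bounded by the
   negative abscissa. *)
have no_eig (mu : R) Z : 0 <= mu -> Z^T = Z -> lyap A G Z = mu *: Z -> Z = 0.
  move=> mu_ge0 Z_sym LZ; apply: contrapT => /eqP Z0.
  suff /s_max /(le_trans mu_ge0) : spectrum (lyap A G) mu%:C%C by rewrite leNgt s_lt0.
  exists (map_mx (real_complex R) Z); split.
  - by rewrite /symmx map_trmx Z_sym.
  - by rewrite map_mx_eq0.
  have -> : mu%:C%C *: map_mx (real_complex R) Z = map_mx (real_complex R) (lyap A G Z).
    by rewrite LZ map_mxZ.
  have ReZ : map_mx (@complex.Re R) (map_mx (real_complex R) Z) = Z.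
    by apply/matrixP => i j; rewrite !mxE.
  have ImZ : map_mx (@complex.Im R) (map_mx (real_complex R) Z) = 0.
    by apply/matrixP => i j; rewrite !mxE.
  by apply/matrixP => i j; rewrite mxE ReZ ImZ lyap0 [in RHS]mxE [X in Complex _ X]mxE.
have [S S_pd LS] : exists2 S, posdef S & forall v, v != 0 -> qform (lyap A^T G^T S) v < 0.
  apply: (lyap_stable_posdef n_gt0) => mu Z mu_ge0 Z_sym /eqP.
  rewrite lyap_eigen => /eqP LZ.
  apply: (lyap_adjoint_inj (A := A - (mu / 2)%:M) (G := G)) Z_sym _ => [W W_sym LW|].
    by apply: (no_eig mu) => //; apply/eqP; rewrite lyap_eigen LW.
  by rewrite -LZ [(A - _)^T]raddfB /= tr_scalar_mx.
exact: (lyap_compare_posdef n_gt0 S_pd P_sym LS LP).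
Qed.

Lemma qform1_eigen M a (u : 'rV[R]_n) : u *m M = a *: u ->
  qform M u^T = a * qform 1%:M u^T.
Proof. by move=> uM; rewrite /qform trmxK uM mulmx1 -scalemxAl mxE. Qed.

(** The matrix [t%:M - M] is positive semidefinite with form zero at [v0], so it kills [v0]. *)
Lemma eigen_of_rayleigh M t v0 : M^T = M -> v0 != 0 ->
  (forall v, qform M v <= t * qform 1%:M v) ->
  qform M v0 = t * qform 1%:M v0 -> eigenvalue M t.
Proof.
move=> M_sym v00 t_max v0E.
have T_sym : (t%:M - M)^T = t%:M - M by rewrite linearB /= tr_scalar_mx M_sym.
have TE v : qform (t%:M - M) v = t * qform 1%:M v - qform M v.
  by rewrite -scalemx1 qformB qformZ.
have Tv0 : (t%:M - M) *m v0 = 0.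
  by apply: (psd_ker T_sym) => [w|]; rewrite TE ?subr_ge0 // v0E subrr.
apply/eigenvalueP; exists v0^T; last by rewrite trmx_eq0.
move: Tv0; rewrite mulmxBl mul_scalar_mx => /eqP; rewrite subr_eq0 => /eqP Mv0.
by rewrite -{1}M_sym -trmx_mul -Mv0 linearZ.
Qed.

(** The maximal Rayleigh quotient is an eigenvalue and bounds all others, so it is the value of
    [set_max]. *)
Lemma lambda_maxP M : M^T = M ->
  (exists2 v0, v0 != 0 & qform M v0 = lambda_max M * qform 1%:M v0) /\
  forall v, qform M v <= lambda_max M * qform 1%:M v.
Proof.
move=> M_sym; have [t [[v0 v00 v0E] t_max]] := rayleigh_quotient n_gt0 M (posdef1 (n := n)).
suff -> : lambda_max M = t by split=> //; exists v0.
apply: set_maxP; first exact: eigen_of_rayleigh v0E.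
move=> a /eigenvalueP[u uM u0].
have uT0 : u^T != 0 by rewrite trmx_eq0.
by have := t_max u^T; rewrite (qform1_eigen uM) ler_pM2r // qform1_gt0.
Qed.

Lemma lambda_minP M : M^T = M ->
  (exists2 v0, v0 != 0 & qform M v0 = lambda_min M * qform 1%:M v0) /\
  forall v, lambda_min M * qform 1%:M v <= qform M v.
Proof.
move=> M_sym.
have NM_sym : (- M)^T = - M by rewrite linearN /= M_sym.
have [t [[v0 v00 v0E] t_max]] := rayleigh_quotient n_gt0 (- M) (posdef1 (n := n)).
have t_min v : - t * qform 1%:M v <= qform M v.
  by have := t_max v; rewrite qformN mulNr lerNl.
suff -> : lambda_min M = - t.
  by split=> //; exists v0 => //; rewrite mulNr -v0E qformN opprK.
apply: set_minP => [|a /eigenvalueP[u uM u0]].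
  have /eigenvalueP[u uM u0] := eigen_of_rayleigh NM_sym v00 t_max v0E.
  by apply/eigenvalueP; exists u => //; rewrite scaleNr -uM mulmxN opprK.
have := t_min u^T; rewrite (qform1_eigen uM) ler_pM2r // qform1_gt0 //.
by rewrite trmx_eq0.
Qed.

End Stability.

(** * Policy improvement *)

Section PolicyImprovement.
Context {R : realType} {n m : nat}.
Implicit Types (A C P Q : 'M[R]_n) (B D : 'M[R]_(n, m)) (K : 'M[R]_(m, n)).

Lemma qform_lyap_tr A C P (v : 'cV[R]_n) : P^T = P ->
  qform (lyap A^T C^T P) v = 2 * (v^T *m P *m (A *m v)) ord0 ord0 + qform P (C *m v).
Proof.
move=> P_sym; rewrite /lyap !trmxK !qformD qform_conj; congr (_ + _).
rewrite mulr_natl mulr2n /qform; congr (_ + _); last by rewrite !mulmxA.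
by rewrite -(sym_bilin _ _ P_sym) trmx_mul !mulmxA.
Qed.

(* Completing the square in the gain. *)
Lemma qform_policy_improvement A B C D P Q (Ra : 'M[R]_m) K K' (v : 'cV[R]_n) :
  P^T = P -> Ra^T = Ra ->
  (Ra + D^T *m P *m D) *m K' = B^T *m P + D^T *m P *m C ->
  qform (lyap (A - B *m K)^T (C - D *m K)^T P + Q + K^T *m Ra *m K) v =
  qform (lyap (A - B *m K')^T (C - D *m K')^T P + Q + K'^T *m Ra *m K') v
  + qform (Ra + D^T *m P *m D) ((K - K') *m v).
Proof.
move=> P_sym Ra_sym SK'.
have [d dE] : exists d, (K - K') *m v = d by eexists.
have [g gE] : exists g, (C - D *m K') *m v = g by eexists.
have [k kE] : exists k, K' *m v = k by eexists.
have KE : K *m v = k + d by rewrite -kE -dE -mulmxDl addrC subrK.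
have AE : (A - B *m K) *m v = (A - B *m K') *m v - B *m d.
  by rewrite !mulmxBl -!mulmxA KE kE mulmxDr opprD addrA.
have CE : (C - D *m K) *m v = g - D *m d.
  by rewrite -gE !mulmxBl -!mulmxA KE kE mulmxDr opprD addrA.
have Rk : Ra *m k = B^T *m P *m v + D^T *m P *m g.
  rewrite -kE -gE mulmxA.
  have -> : Ra *m K' = B^T *m P + D^T *m P *m C - D^T *m P *m D *m K'.
    by rewrite -SK' mulmxDl addrK.
  by rewrite !(mulmxBl, mulmxBr, mulmxDl, mulNmx) -!mulmxA addrA.
(* The equation defining [K'] is the first-order optimality condition; paired with [d], it makes the
   terms linear in [d] cancel. *)
have key : (k^T *m Ra *m d) ord0 ord0 =
    (v^T *m P *m (B *m d)) ord0 ord0 + ((D *m d)^T *m P *m g) ord0 ord0.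
  rewrite (sym_bilin _ _ Ra_sym) -!mulmxA Rk mulmxDr !mulmxA [LHS]mxE; congr (_ + _).
    by rewrite -trmx_mul (sym_bilin _ _ P_sym) !mulmxA.
  by rewrite trmx_mul.
rewrite !(qformD (_ + Q)) !(qformD _ Q) !qform_lyap_tr // !qform_conj KE AE CE.
have -> X : (v^T *m P *m (X - B *m d)) ord0 ord0 =
    (v^T *m P *m X) ord0 ord0 - (v^T *m P *m (B *m d)) ord0 ord0.
  by rewrite mulmxBr [LHS]mxE [X in _ + X]mxE.
have PgE : qform P (g - D *m d) = qform P g - 2 * ((D *m d)^T *m P *m g) ord0 ord0
    + qform (D^T *m P *m D) d.
  rewrite -[- (D *m d)]scaleN1r addrC qform_add // qform_scale qform_conj.
  by rewrite [(-1 *: _)^T]linearZ /= -!scalemxAl mxE; ring.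
rewrite PgE (qform_add _ _ Ra_sym) key (qformD Ra) gE kE dE; ring.
Qed.

End PolicyImprovement.

(** * The policy iteration *)

Lemma posdef_unitmx (R : realType) (n : nat) (M : 'M[R]_n) : posdef M -> M \in unitmx.
Proof.
move=> [M_sym M_gt0]; rewrite -row_free_unit -kermx_eq0; apply/eqP/row_matrixP => i.
rewrite row0; apply: contrapT => /eqP u0; set u := row i (kermx M) in u0.
have uT0 : u^T != 0 by rewrite trmx_eq0.
have uM : u *m M = 0 by apply/sub_kermxP; exact: row_sub.
by have := M_gt0 _ uT0; rewrite trmxK uM mul0mx mxE ltxx.
Qed.

Lemma spectral_abscissa_opLa (R : realType) (n m : nat) (A C : 'M[R]_n)
    (B D : 'M[R]_(n, m)) (rbar c : R) (K : 'M[R]_(m, n)) : (0 < n)%N ->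
  spectral_abscissa (opLa A B C D rbar K c) =
  spectral_abscissa (opL A B C D K) + 2 * c - rbar.
Proof.
move=> n_gt0.
rewrite -[opLa _ _ _ _ _ _ _]/(lyap (shiftedA A B rbar K c) (C - D *m K)).
rewrite -[opL _ _ _ _ _]/(lyap (A - B *m K) (C - D *m K)).
have -> : shiftedA A B rbar K c = A - B *m K + (c - rbar / 2)%:M.
  by rewrite /shiftedA raddfB /= addrAC -!addrA; congr (_ + _); rewrite addrCA [_ - _]addrC.
by rewrite spectral_abscissa_shift //; lra.
Qed.

Theorem lemma6 (R : realType) (n m : nat) (n_gt0 : (0 < n)%N)
  (A : 'M[R]_n) (B : 'M[R]_(n, m)) (C : 'M[R]_n) (D : 'M[R]_(n, m))
  (Qa : 'M[R]_n) (Ra : 'M[R]_m) (beta alpha0 eps theta rmax rbar : R)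
  (K : nat -> 'M[R]_(m, n)) (P : nat -> 'M[R]_n) (c alpha : nat -> R)
  (Qa_posdef : posdef Qa) (Ra_posdef : posdef Ra)
  (beta_gt0 : 0 < beta)
  (alpha0_bound : 0 < 2 * alpha0 < beta)
  (eps_ge0 : 0 <= eps)
  (theta_bound : 0 < theta < 1)
  (K_init : K 0%N = 0)
  (c_init : c 0%N = alpha0)
  (rmax_def : rmax = Num.max 0 (spectral_abscissa (opL A B C D (K 0%N))))
  (rbar_def : rbar = rmax + beta)
  (P_sym : forall k : nat, symmx (P k))
  (P_eq : forall k : nat,
     0 = (shiftedA A B rbar (K k) (c k))^T *m P k
         + P k *m shiftedA A B rbar (K k) (c k)
         + (C - D *m K k)^T *m P k *m (C - D *m K k)
         + Qa + (K k)^T *m Ra *m K k)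
  (K_update : forall k : nat,
     K k.+1 = invmx (Ra + D^T *m P k *m D) *m (B^T *m P k + D^T *m P k *m C))
  (alpha_update : forall k : nat,
     alpha k.+1 = theta * lambda_min Qa / (2 * lambda_max (P k)))
  (c_update : forall k : nat, c k.+1 = c k + alpha k.+1) :
  (forall k : nat,
     [/\ spectral_abscissa (opLa A B C D rbar (K k) (c k)) < 0,
         spectral_abscissa (opL A B C D (K k)) < rbar - 2 * c k,
         0 < alpha k.+1
       & alpha k.+1
         < - (1 / 2) * spectral_abscissa (opLa A B C D rbar (K k.+1) (c k))])
  /\ (forall kstar : nat, rbar - 2 * c kstar < - eps -> - eps <= 0 ->
        Kms A B C D (K kstar)
        /\ spectral_abscissa (opL A B C D (K kstar)) < - eps).
Proof.
have [s sE] : exists s, forall k, spectral_abscissa (opL A B C D (K k)) = s k by eexists.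
have opLaE k x : spectral_abscissa (opLa A B C D rbar (K k) x) = s k + 2 * x - rbar.
  by rewrite spectral_abscissa_opLa // sE.
have [[v0 v00 v0E] Qa_ge] := lambda_minP n_gt0 Qa_posdef.1.
have lmin_gt0 : 0 < lambda_min Qa.
  have : 0 < qform Qa v0 by apply: Qa_posdef.2.
  by rewrite v0E pmulr_lgt0 // qform1_gt0.
have P_lyap k : lyap (shiftedA A B rbar (K k) (c k))^T (C - D *m K k)^T (P k)
    + Qa + (K k)^T *m Ra *m K k = 0.
  by rewrite [RHS](P_eq k) /lyap !trmxK.
(* By [opLaE] the hypothesis is stability at [(K k, c k)]. It makes [P k] positive definite, and
   [P k] is then a Lyapunov certificate at the next gain and shift. *)
have step k : s k + 2 * c k - rbar < 0 ->
    0 < alpha k.+1 /\ s k.+1 + 2 * (c k + alpha k.+1) - rbar < 0.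
  move=> s_lt0; have P_pd : posdef (P k).
    apply: (abscissa_lt0_posdef n_gt0
      (A := shiftedA A B rbar (K k) (c k)) (G := C - D *m K k)).
    - by rewrite -[lyap _ _]/(opLa A B C D rbar (K k) (c k)) opLaE.
    - exact: P_sym.
    move=> v v0'; have := congr1 (fun M => qform M v) (P_lyap k).
    rewrite /= (qformD (_ + Qa)) (qformD _ Qa) qform_conj.
    have : 0 < qform Qa v by apply: Qa_posdef.2.
    have := posdef_ge0 (K k *m v) Ra_posdef.
    by rewrite qform_0l; lra.
  have [[w w0 wE] P_le] := lambda_maxP n_gt0 P_pd.1.
  have lmax_gt0 : 0 < lambda_max (P k).
    have : 0 < qform (P k) w by apply: P_pd.2.
    by rewrite wE pmulr_lgt0 // qform1_gt0.
  have [theta_gt0 theta_lt1] := andP theta_bound.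
  have alpha_gt0 : 0 < alpha k.+1 by rewrite alpha_update divr_gt0 // mulr_gt0.
  split=> //.
  have S_pd : posdef (Ra + D^T *m P k *m D).
    split=> [|v v0'].
      by rewrite /symmx linearD /= !trmx_mul trmxK P_sym Ra_posdef.1 mulmxA.
    rewrite -/(qform _ v) qformD qform_conj ltr_pwDl ?posdef_ge0 //.
    exact: Ra_posdef.2.
  have SK : (Ra + D^T *m P k *m D) *m K k.+1 = B^T *m P k + D^T *m P k *m C.
    by rewrite K_update mulmxA mulmxV ?mul1mx // posdef_unitmx.
  rewrite -opLaE.
  apply: (abscissa_lt0 n_gt0 P_pd) => v v0'.
  have -> : shiftedA A B rbar (K k.+1) (c k + alpha k.+1)
      = shiftedA A B rbar (K k.+1) (c k) + (alpha k.+1)%:M.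
    by rewrite /shiftedA raddfD /= addrA [RHS]addrAC.
  rewrite linearD /= tr_scalar_mx lyap_shift qformD qformZ.
  (* At the old gain the left side vanishes by the equation for [P k], so at the new gain the form
     of the operator is at most [- qform Qa v]. *)
  have := qform_policy_improvement (A - (rbar / 2)%:M + (c k)%:M) Qa (K k) v
    (P_sym k) Ra_posdef.1 SK.
  rewrite -!/(shiftedA A B rbar _ (c k)) P_lyap.
  rewrite (qformD (_ + Qa)) (qformD _ Qa) qform_conj.
  have := posdef_ge0 (K k.+1 *m v) Ra_posdef.
  have := posdef_ge0 ((K k - K k.+1) *m v) S_pd.
  have := Qa_ge v; have := P_le v; have := qform1_gt0 v0'.
  have alphaE : 2 * alpha k.+1 * lambda_max (P k) = theta * lambda_min Qa.
    by rewrite alpha_update; field; rewrite gt_eqF.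
  rewrite qform_0l.
  set q := qform 1%:M v; set p := qform (P k) v => q_gt0 p_le.
  (* The extra shift adds [2 * alpha k.+1 * p]; since [theta < 1] this stays strictly below
     [qform Qa v]. *)
  have : 2 * alpha k.+1 * p < lambda_min Qa * q.
    apply: le_lt_trans (_ : theta * lambda_min Qa * q < _).
      by rewrite -alphaE -!mulrA !ler_pM2l.
    by rewrite -mulrA gtr_pMl ?mulr_gt0.
  lra.
(* At the start [s 0 <= rmax], and [2 * alpha0 < beta] leaves a strict margin. *)
have stable k : s k + 2 * c k - rbar < 0.
  elim: k => [|k /step[_]]; last by rewrite c_update.
  have : s 0%N <= rmax by rewrite rmax_def sE le_max lexx orbT.
  by rewrite c_init rbar_def; lra.
split=> [k|k].
  have s_lt0 := stable k; have [alpha_gt0 s_lt] := step k s_lt0.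
  have s_lt' : s k < rbar - 2 * c k by lra.
  (* Raising the shift from [c k] by [alpha k.+1] adds twice that step to the abscissa, so stability
     after the step is exactly the upper bound on the step length. *)
  have alpha_lt : alpha k.+1 < - (1 / 2) * (s k.+1 + 2 * c k - rbar) by lra.
  rewrite -opLaE in s_lt0; rewrite -opLaE in alpha_lt.
  by split; [exact: s_lt0|rewrite sE; exact: s_lt'|exact: alpha_gt0|exact: alpha_lt].
move=> rc_lt eps_le; have := stable k; rewrite /Kms /= !sE; lra.
Qed.
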